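(* Let $p$ be a prime and $q=p^r$. Suppose there is an integer $b$ with $1<b<p-1$ and $\gcd(b,q-1)=1$. Then for every $n\ge 1$ there exists a local permutation polynomial $F\in\mathbb{F}_p[x_1,\dots,x_n]$ (viewed over $\mathbb{F}_q$) of degree $n(q-2)$.
   Context: $\mathbb{F}_q$ is the finite field with $q=p^r$ elements. A polynomial $f\in\mathbb{F}_q[x_1,\dots,x_n]$ is a local permutation polynomial (LPP) if, for each $i$ and each choice of the other coordinates $(a_j)_{j\ne i}\in\mathbb{F}_q^{n-1}$, the univariate polynomial in $x_i$ obtained by fixing $x_j=a_j$ for $j\ne i$ induces a bijection of $\mathbb{F}_q$. Polynomials are reduced (degree $<q$ in each variable), and degree means total degree. *)

(* Defs.v *)
From mathcomp Require Import all_boot all_algebra all_field.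
From mathcomp Require Import mpoly.
Set Implicit Arguments. Unset Strict Implicit. Unset Printing Implicit Defensive.
Import GRing.Theory.
Local Open Scope ring_scope.

Definition reduced_mpoly (K : finFieldType) (n : nat) (F : {mpoly K[n]}) : Prop :=
  forall m, m \in msupp F -> forall i : 'I_n, (m i < #|K|)%N.

Definition prime_field_coeffs (K : finFieldType) (n : nat) (F : {mpoly K[n]}) : Prop :=
  forall m, exists k : nat, F@_m = k%:R.

Definition is_LPP (K : finFieldType) (n : nat) (F : {mpoly K[n]}) : Prop :=
  forall (i : 'I_n) (a : 'I_n -> K),
    bijective (fun x : K => F.@[fun j : 'I_n => if j == i then x else a j]).

(* Total degree: msize F = tdeg F + 1 for F != 0 (msize 0 = 0). *)
Definition has_total_degree (K : finFieldType) (n : nat) (F : {mpoly K[n]}) (d : nat) : Prop :=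
  msize F = d.+1.

(* Main.v *)
Require Import Defs.
From mathcomp Require Import all_boot all_algebra all_field.
From mathcomp Require Import mpoly.
From mathcomp Require Import zify.

Set Implicit Arguments. Unset Strict Implicit. Unset Printing Implicit Defensive.
Import GRing.Theory.
Local Open Scope ring_scope.

(** Let c be an inverse of b modulo q - 1, write 1/u for u^(q-2), and set
    f_1 = x_1, f_(k+1) = x_(k+1)^c - 1/f_k, F = (1 + 1/f_n)^b.  Every step is
    bijective in each argument, so F is a local permutation polynomial, and
    it has coefficients in F_p.  Reduced local permutation polynomials have
    degree at most q - 2 in each variable, so the degree is n(q-2) as soon as
    the coefficient of the product of the x_i^(q-2) is nonzero; up to sign
    it is the sum of F(a) a_1 ... a_n over all points a.  Substituting
    y = (v + 1/u)^b, which amounts to v = y^c - 1/u, and using that the sum of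
    u^k (v + 1/u)^b over u is - C(b, k) v^(b-k), one sums out one variable at a
    time: the weight u is turned into u^(b-1), then back into u, and so on,
    each time up to the factor - b, which is nonzero modulo p. *)

(** * Power sums over a finite field *)

Section PowerSums.
Variables (K : finFieldType) (q : nat).
Hypothesis cardK : #|K| = q.

Lemma card_gt1 : (1 < q)%N.
Proof. by rewrite -cardK; apply: finNzRing_gt1. Qed.

Lemma expf_card_pred (x : K) : x != 0 -> x ^+ (q - 1) = 1.
Proof.
move=> x0; apply: (mulfI x0); rewrite mulr1 -exprS.
by rewrite subn1 (ltn_predK card_gt1) -cardK expf_card.
Qed.

Lemma expf_card_sub2 (x : K) : (2 < q)%N -> x ^+ (q - 2) = x^-1.
Proof.
move=> q2; have [->|x0] := eqVneq x 0.
  by rewrite invr0 expr0n; have -> : (q - 2 == 0)%N = false by lia.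
apply: (mulfI x0); rewrite mulfV // -exprS -(expf_card_pred x0).
by congr (_ ^+ _); lia.
Qed.

(** The shift x -> x + 1 permutes [K], so the sum of all elements absorbs q. *)
Lemma natr_card : q%:R = 0 :> K.
Proof.
apply: (addrI (\sum_(x : K) x)); rewrite addr0.
rewrite [RHS](reindex_inj (addIr 1)) big_split /=; congr (_ + _).
by rewrite sumr_const cardK.
Qed.

(** Otherwise X^k - 1, with k the nonzero remainder of j modulo q - 1, would have more roots than
    its degree. *)
Lemma exists_expf_neq1 j : ~~ (q - 1 %| j)%N ->
  exists2 g : K, g != 0 & g ^+ j != 1.
Proof.
have q1 := card_gt1; move=> ndv.
have [/existsP[g /andP[g0 gj]]|/existsPn all1] :=
  boolP [exists g : K, (g != 0) && (g ^+ j != 1)]; first by exists g.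
pose k := (j %% (q - 1))%N.
have k0 : (0 < k)%N by rewrite lt0n.
have kq : (k < q - 1)%N by rewrite ltn_mod; lia.
pose P : {poly K} := 'X^k - 1%:P; pose rs := enum (predC1 (0 : K)).
have szP : size P = k.+1 by rewrite size_XnsubC.
have szrs : size rs = (q - 1)%N by rewrite -cardE cardC1 cardK subn1.
have: (size rs < size P)%N.
  apply: max_poly_roots; rewrite ?enum_uniq //.
    by rewrite -size_poly_eq0 szP.
  apply/allP=> x; rewrite mem_enum inE => x0.
  rewrite rootE !hornerE subr_eq0.
  have := all1 x; rewrite x0 /= negbK => /eqP.
  rewrite {1}(divn_eq j (q - 1)) exprD mulnC exprM expf_card_pred //.
  by rewrite expr1n mul1r => ->.
by rewrite szP szrs; lia.
Qed.

(** If q - 1 does not divide j, scaling x by g with g^j != 1 permutes [K] but multiplies the sum by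
    g^j. The case j = 0 is apart because 0^0 = 1, so the sum is q = 0. *)
Lemma sum_expf j :
  \sum_(x : K) x ^+ j = - ((0 < j) && (q - 1 %| j))%N%:R.
Proof.
case: j => [|j] /=.
  under eq_bigr do rewrite expr0.
  by rewrite sumr_const cardK natr_card oppr0.
have [dv|ndv] := boolP (q - 1 %| j.+1)%N.
  rewrite (bigD1 0) //= expr0n /= add0r.
  rewrite (eq_bigr (fun=> 1)) => [|x x0]; last first.
    by case/dvdnP: dv => i ->; rewrite mulnC exprM expf_card_pred // expr1n.
  rewrite sumr_const cardC1 cardK -subn1 natrB ?natr_card ?sub0r //.
  exact: ltnW card_gt1.
have [g g0 gj] := exists_expf_neq1 ndv; rewrite oppr0.
set S := \sum_x _; have: (g ^+ j.+1 - 1) * S = 0.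
  rewrite mulrBl mul1r mulr_sumr; apply/eqP; rewrite subr_eq0; apply/eqP.
  rewrite /S [RHS](reindex_inj (mulfI g0)) /=.
  by apply: eq_bigr => x _; rewrite exprMn.
by move/eqP; rewrite mulf_eq0 subr_eq0 (negPf gj) => /eqP.
Qed.

Lemma sum_expf_invf k i : (2 < q)%N -> (0 < k < q - 1)%N -> (i < q - 1)%N ->
  \sum_(x : K) x ^+ k * x^-1 ^+ i = - (i == k)%:R.
Proof.
move=> q2 /andP[k0 kq] iq.
under eq_bigr do rewrite -expf_card_sub2 // -exprM -exprD.
rewrite sum_expf; congr (- _%:R).
(* The exponent is congruent to k - i modulo q - 1, and |k - i| < q - 1. *)
suff -> : ((q - 1) %| k + (q - 2) * i)%N = (i == k) by lia.
case: (leqP i k) => ik.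
  have -> : (k + (q - 2) * i = (q - 1) * i + (k - i))%N by nia.
  rewrite dvdn_addr ?dvdn_mulr // /dvdn modn_small; lia.
have -> : (k + (q - 2) * i = (q - 1) * (i - 1) + (q - 1 - (i - k)))%N by nia.
rewrite dvdn_addr ?dvdn_mulr // /dvdn modn_small; lia.
Qed.

(* The family dual to the monomials 1, x, ..., x^(q-1). *)
Definition coef_weight (k : nat) (x : K) : K := (k == 0%N)%:R - x ^+ (q - 1 - k).

(** The exponent l + (q - 1 - k) is a positive multiple of q - 1 only for l = k, or for k = 0 and l
    = q - 1; the constant term of [coef_weight] cancels the latter case. *)
Lemma sum_coef_weight k l : (k < q)%N -> (l < q)%N ->
  \sum_(x : K) x ^+ l * coef_weight k x = (l == k)%:R.
Proof.
have q1 := card_gt1; move=> kq lq.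
rewrite /coef_weight; under eq_bigr do rewrite mulrBr -exprD.
rewrite big_split sumrN -mulr_suml !sum_expf /= opprK.
have [->|k0] := eqVneq k 0%N.
  rewrite mulr1 subn0; case: l lq => [|l] lq; last by rewrite dvdn_addl // addNr.
  by rewrite add0n dvdnn andbT oppr0 add0r subn_gt0 q1.
rewrite mulr0 add0r; congr (_%:R).
have [->|lk] := eqVneq l k.
  have -> : (k + (q - 1 - k) = q - 1)%N by lia.
  by rewrite dvdnn andbT subn_gt0 q1.
case: (ltngtP l k) lk => // lk _.
  by rewrite /dvdn modn_small; [rewrite eqn0Ngt andbN | lia].
have -> : (l + (q - 1 - k) = (q - 1) + (l - k))%N by lia.
by rewrite dvdn_addr // /dvdn modn_small; lia.
Qed.

End PowerSums.

(** * Coefficients of reduced polynomials from their values *)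

Section ReducedPolynomials.
Variables (K : finFieldType) (q n : nat).
Hypothesis cardK : #|K| = q.

(** For each monomial of F the sum over all points factors into one-variable sums, and duality
    selects m. *)
Lemma mcoeff_reduced (F : {mpoly K[n]}) (m : 'X_{1.. n}) :
  reduced_mpoly F -> (forall i, m i < q)%N ->
  F@_m = \sum_(a : {ffun 'I_n -> K}) F.@[a] * \prod_i coef_weight q (m i) (a i).
Proof.
move=> redF mq.
under eq_bigr => a _ do rewrite mevalE mulr_suml.
rewrite exchange_big /= {1}(mpolyE F) raddf_sum /=.
apply: eq_big_seq => l lF; rewrite mcoeffZ mcoeffX.
under eq_bigr => a _ do rewrite -mulrA -big_split /=.
rewrite -mulr_sumr; congr (_ * _).
rewrite -(bigA_distr_bigA (fun i x => x ^+ l i * coef_weight q (m i) x)).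
under eq_bigr => i _ do
  rewrite (sum_coef_weight cardK (mq i)) -?cardK ?redF //.
have [->|/eqP lm] := eqVneq l m; first by rewrite big1 // => i _; rewrite eqxx.
have [/existsP[i lmi]|/existsPn h] := boolP [exists i, l i != m i].
  by rewrite (bigD1 i) //= (negPf lmi) mul0r.
by case: lm; apply/mnmP => i; have /negPn/eqP := h i.
Qed.

Lemma sum_ffun_fiber (i : 'I_n) (G : {ffun 'I_n -> K} -> K) :
  (forall a : 'I_n -> K,
     \sum_(x : K) G [ffun j => if j == i then x else a j] = 0) ->
  \sum_a G a = 0.
Proof.
move=> G0; pose base (a : {ffun 'I_n -> K}) := [ffun j => if j == i then 0 else a j].
rewrite (partition_big base predT) //= big1 // => c _.
(* A line parallel to the i-th axis is indexed by its point with i-th coordinate 0; other indices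
   give empty fibers. *)
have [/eqP ci|ci] := boolP (c i == 0); last first.
  rewrite big_pred0 // => a; apply/negP => /eqP ac.
  by rewrite -ac ffunE eqxx eqxx in ci.
rewrite -[RHS](G0 c).
rewrite (reindex_onto (fun x => [ffun j => if j == i then x else c j])
                      (fun a : {ffun 'I_n -> K} => a i)) /=.
  apply: eq_bigl => x; rewrite ffunE !eqxx andbT; apply/eqP/ffunP => j.
  by rewrite !ffunE; case: eqP => // ->.
move=> a /eqP ac; apply/ffunP => j; rewrite !ffunE.
by case: eqP => [->//|/eqP ji]; rewrite -ac ffunE (negPf ji).
Qed.

(* The coefficients of degree q - 1 in x_i are weighted sums of the values of F along
   lines parallel to the i-th axis, and such a line takes every value once. *)
Lemma LPP_degree (F : {mpoly K[n]}) (m : 'X_{1.. n}) (i : 'I_n) :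
  (2 < q)%N -> reduced_mpoly F -> is_LPP F -> m \in msupp F -> (m i <= q - 2)%N.
Proof.
move=> q2 redF lppF mF.
have mq j : (m j < q)%N by rewrite -cardK redF.
rewrite leqNgt; apply/negP => mi.
have {mi} mi : m i = (q - 1)%N by have := mq i; lia.
move: mF; rewrite mcoeff_msupp mcoeff_reduced // => /eqP[].
apply: (@sum_ffun_fiber i) => a.
(* The weight for exponent q - 1 is the constant -1, so only F depends on x. *)
rewrite (eq_bigr (fun x => F.@[fun j => if j == i then x else a j] *
   (- \prod_(j | j != i) coef_weight q (m j) (a j)))); last first.
  move=> x _; congr (_ * _); first by apply: meval_eq => j; rewrite ffunE.
  rewrite (bigD1 i) //= mi /coef_weight subnn expr0.
  have -> : (q - 1 == 0)%N = false by lia.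
  rewrite sub0r mulN1r; congr (- _); apply: eq_bigr => j ji.
  by rewrite ffunE (negPf ji).
rewrite -mulr_suml.
have := sum_expf cardK 1; rewrite (reindex _ (onW_bij _ (lppF i a))) /=.
under eq_bigr do rewrite expr1.
move=> ->; rewrite dvdn1; have -> : (q - 1 == 1)%N = false by lia.
by rewrite oppr0 mul0r.
Qed.

Lemma LPP_msize (F : {mpoly K[n]}) :
  (2 < q)%N -> reduced_mpoly F -> is_LPP F ->
  \sum_(a : {ffun 'I_n -> K}) F.@[a] * \prod_i a i != 0 ->
  msize F = (n * (q - 2)).+1.
Proof.
move=> q2 redF lppF topF.
pose m : 'X_{1.. n} := [multinom (q - 2)%N | i < n].
have mdegm : mdeg m = (n * (q - 2))%N.
  rewrite mdegE; under eq_bigr do rewrite mnmE.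
  by rewrite sum_nat_const card_ord.
have mF : m \in msupp F.
  rewrite mcoeff_msupp mcoeff_reduced // => [|i]; last by rewrite mnmE; lia.
  (* The weight for exponent q - 2 is -x, whence the sign (-1)^n. *)
  rewrite (eq_bigr (fun a : {ffun 'I_n -> K} => (F.@[a] * \prod_i a i) * (-1) ^+ n)).
    by rewrite -mulr_suml mulf_neq0 // signr_eq0.
  move=> a _; rewrite -mulrA; congr (_ * _).
  rewrite mulrC -[n in _ ^+ n]card_ord -prodrN; apply: eq_bigr => i _.
  rewrite mnmE /coef_weight; have -> : (q - 2 == 0)%N = false by lia.
  have -> : (q - 1 - (q - 2) = 1)%N by lia.
  by rewrite sub0r expr1.
apply/eqP; rewrite eqn_leq -{2}mdegm msize_mdeg_lt // andbT msizeE.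
apply/bigmax_leqP_seq => l lF _; rewrite ltnS mdegE.
rewrite -[n in (n * _)%N]card_ord -sum_nat_const; apply: leq_sum => i _.
exact: (LPP_degree i q2 redF lppF lF).
Qed.
End ReducedPolynomials.

(** * Reduced polynomials with prime field coefficients *)

Section ReduceExponents.
Variables (K : finFieldType) (q n : nat).
Hypothesis cardK : #|K| = q.

(** Positive exponents go to 1, ..., q - 1 and only 0 goes to 0, since x^(q-1) and x^0 differ at x =
    0. *)
Definition reduce_exponent (k : nat) : nat :=
  if k is k'.+1 then (k' %% (q - 1)).+1 else 0.

Lemma expf_reduce_exponent (x : K) k : x ^+ reduce_exponent k = x ^+ k.
Proof.
case: k => [//|k] /=; have [->|x0] := eqVneq x 0; first by rewrite !expr0n.
rewrite !exprS; congr (_ * _); rewrite {2}(divn_eq k (q - 1)) mulnC exprD exprM.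
by rewrite expf_card_pred // expr1n mul1r.
Qed.

Lemma reduce_exponent_lt k : (reduce_exponent k < q)%N.
Proof.
have q1 := card_gt1 cardK; case: k => [|k] /=; first by lia.
by have : (k %% (q - 1) < q - 1)%N; [rewrite ltn_mod; lia|lia].
Qed.

(** Starting from integer coefficients keeps the result over the prime field. *)
Definition reduce_int_mpoly (G : {mpoly int[n]}) : {mpoly K[n]} :=
  \sum_(m <- msupp G) (G@_m)%:~R *: 'X_[[multinom reduce_exponent (m i) | i < n]].

Lemma meval_reduce_int_mpoly (v : 'I_n -> K) G :
  (reduce_int_mpoly G).@[v] = mmap (intr : int -> K) v G.
Proof.
rewrite /reduce_int_mpoly raddf_sum /= /mmap; apply: eq_bigr => m _.
rewrite mevalZ mevalX; congr (_ * _); apply: eq_bigr => i _.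
by rewrite mnmE expf_reduce_exponent.
Qed.

Lemma reduce_int_mpoly_reduced G : reduced_mpoly (reduce_int_mpoly G).
Proof.
move=> m; rewrite mcoeff_msupp /reduce_int_mpoly raddf_sum /= => mG i.
rewrite cardK; apply: contraNT mG => mi; rewrite big1_seq //= => l _.
rewrite mcoeffZ mcoeffX; case: eqP => [lm|_]; last by rewrite mulr0.
by move: mi; rewrite -lm mnmE reduce_exponent_lt.
Qed.

Lemma reduce_int_mpoly_prime G : prime_field_coeffs (reduce_int_mpoly G).
Proof.
move=> m.
have [z ->] : exists z : int, (reduce_int_mpoly G)@_m = z%:~R.
  rewrite /reduce_int_mpoly raddf_sum /=.
  exists (\sum_(l <- msupp G)
     G@_l * ([multinom reduce_exponent (l i) | i < n] == m)%:R).
  rewrite rmorph_sum /=; apply: eq_bigr => l _.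
  by rewrite mcoeffZ mcoeffX rmorphM /= rmorph_nat.
exists `|(z %% q)%Z|%N.
have q1 := card_gt1 cardK.
rewrite -[LHS]/(z%:~R) {1}(divz_eq z q) rmorphD rmorphM /=.
have -> : (Posz q)%:~R = 0 :> K by rewrite -[LHS]/(q%:R) natr_card.
by rewrite mulr0 add0r -[in LHS](gez0_abs (modz_ge0 _ _)) //; lia.
Qed.
End ReduceExponents.

(** * Sums over tuples, and binomials modulo p *)

Lemma big_tuple_nil (R : nmodType) (T : finType) (G : 0.-tuple T -> R) :
  \sum_t G t = G [tuple].
Proof. by apply: big_pred1 => t; rewrite [t]tuple0 /=; symmetry; apply/eqP. Qed.

Lemma big_tuple_cons (R : nmodType) (T : finType) n (G : n.+1.-tuple T -> R) :
  \sum_t G t = \sum_x \sum_(t : n.-tuple T) G [tuple of x :: t].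
Proof.
rewrite pair_bigA /= (reindex (fun p : T * n.-tuple T => [tuple of p.1 :: p.2])) //.
exists (fun t => (thead t, [tuple of behead t])) => [[x t] _|t _] /=.
  by rewrite theadE; congr (_, _); apply: val_inj.
by rewrite -tuple_eta.
Qed.

Lemma big_ffun_tuple (R : nmodType) (T : finType) n (G : {ffun 'I_n -> T} -> R) :
  \sum_a G a = \sum_(t : n.-tuple T) G [ffun i => tnth t i].
Proof.
rewrite (reindex (fun t : n.-tuple T => [ffun i => tnth t i])) //.
exists (fun a : {ffun 'I_n -> T} => [tuple a i | i < n]) => [t _|a _].
  by apply: eq_from_tnth => i; rewrite tnth_mktuple ffunE.
by apply/ffunP => i; rewrite ffunE tnth_mktuple.
Qed.

(** The binomial divides b!, a product of positive integers below p. *)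
Lemma natr_bin_neq0 (R : nzRingType) p b k :
  p \in [pchar R] -> (b < p)%N -> (k <= b)%N -> 'C(b, k)%:R != 0 :> R.
Proof.
move=> pR bp kb; have pr_p := pcharf_prime pR.
rewrite -(dvdn_pcharf pR); apply/negP => pC.
have: (p %| b`!)%N by rewrite -(bin_fact kb) dvdn_mulr.
elim: b {kb pC} bp => [|b IH] bp; first by rewrite dvdn1 gtn_eqF ?prime_gt1.
rewrite factS Euclid_dvdM // => /orP[/dvdn_leq|/IH].
  by move/(_ isT); rewrite leqNgt bp.
by apply; apply: ltnW.
Qed.

(* [chain_step] computes y^(1/b) - 1/u when c is an inverse of b modulo q - 1
   and e = q - 2. *)
Definition chain_step (R : pzRingType) (e c : nat) (u y : R) : R :=
  y ^+ c - u ^+ e.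

(** Generic in the ring, so that it serves both for integer polynomials and for their values in
    [K]. *)
Definition chain (R : pzRingType) (e c b : nat) (s : seq R) : R :=
  (1 + foldl (chain_step e c) (head 0 s) (behead s) ^+ e) ^+ b.

Lemma rmorph_chain (R S : pzRingType) (f : {rmorphism R -> S}) e c b s :
  f (chain e c b s) = chain e c b (map f s).
Proof.
rewrite /chain rmorphXn rmorphD rmorph1 rmorphXn; congr (_ ^+ _); congr (_ + _ ^+ _).
case: s => [|u s] /=; first exact: rmorph0.
elim: s u => //= y s IH u; rewrite IH; congr foldl.
by rewrite /chain_step rmorphB !rmorphXn.
Qed.

(** * Injectivity and top coefficient of the chain *)

Section Chain.
Variables (K : finFieldType) (q b c : nat).
Hypotheses (cardK : #|K| = q) (q_gt2 : (2 < q)%N) (b_lt : (b < q - 1)%N).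
Hypothesis exprcb : forall x : K, x ^+ c ^+ b = x.

Local Notation step := (@chain_step K (q - 2) c).

Lemma stepE (u y : K) : step u y = y ^+ c - u^-1.
Proof. by rewrite /chain_step (expf_card_sub2 cardK). Qed.

Lemma exprbc (x : K) : x ^+ b ^+ c = x.
Proof. by rewrite exprAC exprcb. Qed.

Lemma exprb_inj : injective (fun x : K => x ^+ b).
Proof. exact: (@can_inj _ _ _ (fun x : K => x ^+ c)) exprbc. Qed.

Lemma exprc_inj : injective (fun x : K => x ^+ c).
Proof. exact: (@can_inj _ _ _ (fun x : K => x ^+ b)) exprcb. Qed.

Lemma step_injl (y : K) : injective (step^~ y).
Proof. by move=> u u'; rewrite !stepE => /addrI/oppr_inj/invr_inj. Qed.

Lemma step_injr (u : K) : injective (step u).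
Proof. by move=> y y'; rewrite !stepE => /addIr /exprc_inj. Qed.

Lemma foldl_step_inj (s : seq K) : injective (fun u => foldl step u s).
Proof. by elim: s => [|y s IH] u u' //= /IH /step_injl. Qed.

Lemma final_inj : injective (fun u : K => (1 + u^-1) ^+ b).
Proof. by move=> u u' /exprb_inj/addrI/invr_inj. Qed.

Lemma chainE (u : K) s : chain (q - 2) c b (u :: s) = (1 + (foldl step u s)^-1) ^+ b.
Proof. by rewrite /chain (expf_card_sub2 cardK). Qed.

(** The entry x is the starting value or the new argument of one step; all later maps are injective
    in the accumulated value. *)
Lemma chain_inj (s1 s2 : seq K) :
  injective (fun x => chain (q - 2) c b (s1 ++ x :: s2)).
Proof.
case: s1 => [|u s1] x x' /=; rewrite !chainE => /final_inj.
  exact: foldl_step_inj.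
by rewrite !foldl_cat /= => /foldl_step_inj/step_injr.
Qed.

Lemma sum_expf_binomial k (v : K) : (0 < k <= b)%N ->
  \sum_(u : K) u ^+ k * (v + u^-1) ^+ b = - ('C(b, k)%:R * v ^+ (b - k)).
Proof.
move=> /andP[k0 kb].
under eq_bigr => u _ do rewrite exprDn mulr_sumr.
rewrite exchange_big /=.
under eq_bigr => i _.
  under eq_bigr => u _ do rewrite mulrnAr mulrCA -mulrnAl.
  have iq : (i < q - 1)%N by have := ltn_ord i; lia.
  rewrite -mulr_sumr (sum_expf_invf cardK) // ?k0 ?(leq_ltn_trans kb) //; over.
(* Only the term i = k of the binomial expansion survives. *)
rewrite /= (bigD1 (inord k)) //= inordK // eqxx big1 ?addr0 => [|i ik].
  by rewrite mulrN1 mulr_natl.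
case: eqP => [ik'|_]; last by rewrite oppr0 mulr0.
by case/eqP: ik; apply: val_inj; rewrite /= inordK.
Qed.

(* Substituting y = (v + 1/u)^b, i.e. v = step u y, separates the variables. *)
Lemma sum_step (h : K -> K) k : (0 < k <= b)%N ->
  \sum_(u : K) u ^+ k * \sum_y y * h (step u y) =
  - 'C(b, k)%:R * \sum_v v ^+ (b - k) * h v.
Proof.
move=> kb.
under eq_bigr => u _.
  rewrite (reindex (fun v => (v + u^-1) ^+ b)) /=; last first.
    exists (step u) => x _; rewrite stepE ?exprbc ?addrK //.
    by rewrite subrK exprcb.
  under eq_bigr => v _ do rewrite stepE exprbc addrK.
  rewrite mulr_sumr; over.
rewrite exchange_big /= mulr_sumr; apply: eq_bigr => v _.
under eq_bigr => u _ do rewrite mulrA.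
by rewrite -mulr_suml sum_expf_binomial // mulNr mulrA mulNr.
Qed.

(** Each summation replaces k by b - k, up to a nonzero factor, and the range 0 < k < b is stable
    under this; hence the induction is over all such k. *)
Lemma sum_chain_neq0 n k :
  (forall i, (i <= b)%N -> 'C(b, i)%:R != 0 :> K) -> (0 < k < b)%N ->
  \sum_(u : K) u ^+ k *
     \sum_(t : n.-tuple K) chain (q - 2) c b (u :: t) * \prod_(x <- t) x != 0.
Proof.
move=> Cb; elim: n k => [|n IH] k /andP[k0 kb].
  under eq_bigr => u _.
    rewrite big_tuple_nil big_nil mulr1 chainE /=; over.
  rewrite /= sum_expf_binomial ?expr1n ?mulr1 ?oppr_eq0 ?Cb ?k0 ?(ltnW kb) //.
pose h v := \sum_(t : n.-tuple K) chain (q - 2) c b (v :: t) * \prod_(x <- t) x.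
under eq_bigr => u _.
  rewrite big_tuple_cons /=.
  under eq_bigr => y _.
    under eq_bigr => t _ do rewrite big_cons mulrCA chainE /= -chainE.
    rewrite -mulr_sumr -/(h _); over.
  over.
rewrite sum_step ?k0 ?(ltnW kb) // mulf_neq0 ?oppr_eq0 ?Cb ?(ltnW kb) //.
by apply: IH; lia.
Qed.
End Chain.

(** * Choice of exponents and construction of the polynomial *)

Lemma exists_exponent_inverse (K : finFieldType) q b :
  #|K| = q -> (0 < b)%N -> coprime b (q - 1) ->
  exists c, forall x : K, x ^+ c ^+ b = x.
Proof.
move=> cardK b0; rewrite /coprime => /eqP cop.
(* Bezout gives c b = d (q - 1) + 1. *)
case: (egcdnP (q - 1) b0) => c d bez _; exists c => x.
rewrite -exprM bez cop exprD expr1 mulnC exprM.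
have [->|x0] := eqVneq x 0; first by rewrite mulr0.
by rewrite (expf_card_pred cardK) // expr1n mul1r.
Qed.

Theorem mainTheorem11 (p r : nat) (K : finFieldType) :
  prime p -> (0 < r)%N -> #|K| = (p ^ r)%N ->
  (exists b : nat, [/\ (1 < b)%N, (b < p - 1)%N & coprime b (p ^ r - 1)]) ->
  forall n : nat, (1 <= n)%N ->
  exists F : {mpoly K[n]},
    [/\ prime_field_coeffs F, reduced_mpoly F, is_LPP F &
        has_total_degree F (n * (p ^ r - 2))].
Proof.
move=> pr_p r0 cardK [b [b1 bp cop]] [//|n] _.
have pK := card_finPcharP cardK pr_p.
have pq : (p <= p ^ r)%N by rewrite -{1}[p]expn1 leq_pexp2l // prime_gt0.
move: (p ^ r)%N cardK cop pq => q cardK cop pq.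
have q2 : (2 < q)%N by lia.
have bq : (b < q - 1)%N by lia.
have [c exprcb] := exists_exponent_inverse cardK (ltnW b1) cop.
pose vars : seq {mpoly int[n.+1]} := [seq 'X_i | i <- enum 'I_n.+1].
pose F : {mpoly K[n.+1]} := reduce_int_mpoly K q (chain (q - 2) c b vars).
have evalF v : F.@[v] = chain (q - 2) c b [seq v i | i <- enum 'I_n.+1].
  rewrite (meval_reduce_int_mpoly cardK) rmorph_chain -map_comp.
  by congr chain; apply: eq_map => i /=; rewrite mmapX mmap1U.
have redF : reduced_mpoly F by apply: reduce_int_mpoly_reduced.
have lppF : is_LPP F.
  move=> i a; apply: injF_bij => x x'; rewrite !evalF.
  (* The index i occurs exactly once among the variables, so splitting there leaves both sides
     independent of x. *)
  have := enum_uniq 'I_n.+1; have: i \in enum 'I_n.+1 by rewrite mem_enum.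
  case/splitPr => s1 s2; rewrite cat_uniq /= negb_or => /and4P[_ /andP[is1 _] is2 _].
  have fixed y s : i \notin s ->
      [seq (if j == i then y else a j) | j <- s] = map a s.
    move=> /negP si; apply/eq_in_map => j js.
    by case: eqP => // ji; case: si; rewrite -ji.
  rewrite !map_cat /= !fixed // eqxx; exact: chain_inj.
exists F; split=> //; first exact: reduce_int_mpoly_prime.
apply: LPP_msize => //; rewrite big_ffun_tuple big_tuple_cons.
have Cb i : (i <= b)%N -> 'C(b, i)%:R != 0 :> K.
  by apply: natr_bin_neq0 pK _; lia.
(* The first variable carries the weight u^1, and 1 < b admits k = 1. *)
have := sum_chain_neq0 cardK q2 bq exprcb n Cb (k := 1) b1.
congr (_ != 0); apply: eq_bigr => x _; rewrite expr1 mulr_sumr.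
apply: eq_bigr => t _; rewrite evalF.
under eq_map => i do rewrite ffunE.
under [in RHS]eq_bigr => i _ do rewrite ffunE.
by rewrite map_tnth_enum -(big_tuple _ _ [tuple of x :: t] xpredT id) big_cons mulrCA.
Qed.
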